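(* Let $P$ be a finite lazy irreducible reversible Markov chain on $\Omega$ with stationary distribution $\pi$, and fix a routing $\theta_{I,F}$ from $I$ to $F$ for every ordered pair $(I,F)\in\Omega\times\Omega$. Put $\mathsf{En}_{\max}:=\max_{I,F}\mathsf{En}(\theta_{I,F})$ and $$\rho_{\mathrm{supp}}:=\max_{e\in\mathcal T}\frac1{2Q(e)}\sum_{\substack{I,F\in\Omega\\ e\in\operatorname{supp}(\theta_{I,F})}}\pi(I)\pi(F).$$ Then for every $f:\Omega\to\mathbb R$, $$\operatorname{Var}_\pi[f]\le\mathsf{En}_{\max}\,\rho_{\mathrm{supp}}\,\mathcal E_P(f,f).$$ Consequently, $\tau_{\mathrm{rel}}(P)\le\mathsf{En}_{\max}\,\rho_{\mathrm{supp}}$.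
   Context: Lazy means $P(x,x)\ge\frac12$ for all $x$. The undirected transition graph has edge set $\mathcal T=\{\{x,y\}:x\ne y,\ P(x,y)>0\}$; the capacity of $e=\{x,y\}\in\mathcal T$ is $Q(e)=\pi(x)P(x,y)=\pi(y)P(y,x)$. $\operatorname{Paths}(I,F)$ is the set of paths from $I$ to $F$ in the transition graph with no repeated vertices (including the empty path when $I=F$). A routing from $I$ to $F$ is a probability distribution $\theta$ on $\operatorname{Paths}(I,F)$. Its transition support is $\operatorname{supp}(\theta)=\{e\in\mathcal T:\Pr_{\gamma\sim\theta}[e\in\gamma]>0\}$ and its energy is $\mathsf{En}(\theta)=\sum_{e\in\mathcal T}\Pr_{\gamma\sim\theta}[e\in\gamma]^2$. The Dirichlet form is $\mathcal E_P(f,f)=\frac12\sum_{x,y}\pi(x)P(x,y)(f(x)-f(y))^2$, and $\tau_{\mathrm{rel}}(P)$ is the smallest $C>0$ such that $\operatorname{Var}_\pi[f]\le C\,\mathcal E_P(f,f)$ for all $f:\Omega\to\mathbb R$ (the inverse spectral gap). *)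

(* Defs.v *)
From HB Require Import structures.
From mathcomp Require Import all_boot all_order all_algebra.
From mathcomp Require Import classical_sets reals.

Set Implicit Arguments.
Unset Strict Implicit.
Unset Printing Implicit Defensive.
Import Order.TTheory GRing.Theory Num.Theory.
Local Open Scope ring_scope.

Section Chain.
Variables (R : realType) (Omega : finType).
Implicit Types (P : Omega -> Omega -> R) (pi f : Omega -> R).

Definition distribution (T : finType) (mu : T -> R) : Prop :=
  (forall x, 0 <= mu x) /\ \sum_x mu x = 1.

Definition markov_kernel P : Prop := forall x, distribution (P x).

Fixpoint kernel_pow P (t : nat) (x y : Omega) : R :=
  if t is t'.+1 then \sum_z P x z * kernel_pow P t' z y else (x == y)%:R.

Definition irreducible P : Prop :=
  forall x y, exists t : nat, 0 < kernel_pow P t x y.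

Definition lazy P : Prop := forall x, 2^-1 <= P x x.

Definition stationary_distribution P pi : Prop :=
  distribution pi /\ forall y, \sum_x pi x * P x y = pi y.

Definition reversible P pi : Prop :=
  forall x y, pi x * P x y = pi y * P y x.

Definition mean pi f : R := \sum_x pi x * f x.

Definition Var pi f : R := \sum_x pi x * (f x - mean pi f) ^+ 2.

Definition dirichlet P pi f : R :=
  2^-1 * \sum_x \sum_y pi x * P x y * (f x - f y) ^+ 2.

Definition poincare_constants P pi : set R :=
  [set C : R | 0 < C /\ forall f, Var pi f <= C * dirichlet P pi f]%classic.

(* For an irreducible chain on at least two points the infimum is attained.
   On a one-point space every C > 0 is admissible, there is no smallest one,
   and the relaxation time is 0 by this definition. *)
Definition tau_rel P pi : R := inf (poincare_constants P pi).

Lemma tau_rel_least P pi (C : R) :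
    poincare_constants P pi C ->
    (forall C', poincare_constants P pi C' -> C <= C') ->
  tau_rel P pi = C.
Proof.
move=> SC leC; have lbC : lbound (poincare_constants P pi) C by [].
apply/eqP; rewrite eq_le; apply/andP; split.
  by apply: ge_inf => //; exists C.
by apply: lb_le_inf => //; exists C.
Qed.

(* An undirected edge {x, y} is the two-element set [set x; y]. *)
Definition transitions P : {set {set Omega}} :=
  [set e : {set Omega} |
    [exists x, exists y, [&& x != y, 0 < P x y & e == [set x; y]]]].

(* The value does not depend on the chosen orientation of e when P is
   reversible, see [capacityE]. *)
Definition capacity P pi (e : {set Omega}) : R :=
  if [pick u : Omega * Omega | (u.1 != u.2) && (e == [set u.1; u.2])] is Some u
  then pi u.1 * P u.1 u.2 else 0.

Lemma capacityE P pi x y : reversible P pi -> x != y ->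
  capacity P pi [set x; y] = pi x * P x y.
Proof.
move=> rev neq_xy; rewrite /capacity; case: pickP => [[a b] /= | /(_ (x, y))].
  case/andP=> neq_ab /eqP eq_e.
  have : a \in [set x; y] by rewrite eq_e set21.
  have : b \in [set x; y] by rewrite eq_e set22.
  rewrite !inE => /orP[] /eqP eq_b /orP[] /eqP eq_a.
  - by rewrite eq_a eq_b eqxx in neq_ab.
  - by rewrite eq_a eq_b rev.
  - by rewrite eq_a eq_b.
  - by rewrite eq_a eq_b eqxx in neq_ab.
by rewrite /= neq_xy eqxx.
Qed.

(* A path is given by the list of the vertices it visits.  The length bound
   only serves to make this a finite type; it holds for any duplicate-free
   list. *)
Definition vertex_seq : finType := #|Omega|.-bseq Omega.

(* The empty path at I is the vertex list [:: I]. *)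
Definition Paths P (I F : Omega) : {set vertex_seq} :=
  [set g : vertex_seq |
    if val g is x :: p
    then [&& x == I, last x p == F,
             path (fun a b => [set a; b] \in transitions P) x p
           & uniq (x :: p)]
    else false].

Definition edges (g : vertex_seq) : seq {set Omega} :=
  [seq [set u.1; u.2] | u <- zip (val g) (behead (val g))].

Implicit Type theta : vertex_seq -> R.

Definition is_routing P (I F : Omega) theta : Prop :=
  distribution theta /\ forall g, g \notin Paths P I F -> theta g = 0.

Definition edge_prob theta (e : {set Omega}) : R :=
  \sum_(g : vertex_seq | e \in edges g) theta g.

Definition routing_supp P theta : {set {set Omega}} :=
  [set e in transitions P | 0 < edge_prob theta e].

Definition energy P theta : R :=
  \sum_(e in transitions P) edge_prob theta e ^+ 2.

Implicit Type Theta : Omega -> Omega -> vertex_seq -> R.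

(* Both maxima below are over nonnegative quantities, so the default value 0
   only matters for an empty index set. *)
Definition En_max P Theta : R :=
  \big[Num.max/0]_(u : Omega * Omega) energy P (Theta u.1 u.2).

Definition rho_supp P pi Theta : R :=
  \big[Num.max/0]_(e in transitions P)
    ((2 * capacity P pi e)^-1 *
     \sum_(u : Omega * Omega | e \in routing_supp P (Theta u.1 u.2))
       pi u.1 * pi u.2).

End Chain.

(* Main.v *)
(* Averaging the telescoping sum of f along a random path from I to F bounds
   |f I - f F| by the sum over edges e of Pr[e in path] |df(e)|, in which only
   the edges of the support contribute.  Cauchy-Schwarz on the support gives
   (f I - f F)^2 <= En(theta) * sum_(e in supp) df(e)^2.  Averaging over
   independent I, F distributed as pi and exchanging the sums over pairs and
   edges makes the congestion rho_supp appear in front of the Dirichlet form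
   sum_e Q(e) df(e)^2. *)
Require Import Defs.
From HB Require Import structures.
From mathcomp Require Import all_boot all_order all_algebra.
From mathcomp Require Import ring lra.
From mathcomp Require Import classical_sets reals.

Set Implicit Arguments.
Unset Strict Implicit.
Unset Printing Implicit Defensive.
Import Order.TTheory GRing.Theory Num.Theory.
Local Open Scope ring_scope.

(** Lagrange's identity: the double sum of squares [(a i * b j - a j * b i) ^+ 2] is twice the
    difference of the two sides. *)
Lemma cauchy_schwarz_sum (R : realFieldType) (I : finType) (A : {pred I})
    (a b : I -> R) :
  (\sum_(i in A) a i * b i) ^+ 2 <=
  (\sum_(i in A) a i ^+ 2) * (\sum_(i in A) b i ^+ 2).
Proof.
have : 0 <= \sum_(i in A) \sum_(j in A) (a i * b j - a j * b i) ^+ 2.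
  by do 2![apply: sumr_ge0 => ? _]; apply: sqr_ge0.
have -> : \sum_(i in A) \sum_(j in A) (a i * b j - a j * b i) ^+ 2 =
    \sum_(i in A) \sum_(j in A) a i ^+ 2 * b j ^+ 2
    + \sum_(i in A) \sum_(j in A) b i ^+ 2 * a j ^+ 2
    - 2 * \sum_(i in A) \sum_(j in A) (a i * b i) * (a j * b j).
  rewrite mulr_sumr -big_split -sumrB /=; apply: eq_bigr => i _.
  rewrite mulr_sumr -big_split -sumrB /=; apply: eq_bigr => j _.
  by ring.
rewrite -!big_distrlr /= expr2.
by set X := \sum_(i in A) a i ^+ 2; set Y := \sum_(i in A) b i ^+ 2; lra.
Qed.

Section Chain.
Variables (R : realType) (Omega : finType).
Variables (P : Omega -> Omega -> R) (pi : Omega -> R).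

Lemma transitionsP (e : {set Omega}) :
  reflect (exists x y, [/\ x != y, 0 < P x y & e = [set x; y]])
          (e \in transitions P).
Proof.
rewrite inE; apply: (iffP existsP) => [[x /existsP[y /and3P[? ? /eqP ?]]]|].
  by exists x, y.
case=> x [y [? ? ?]]; exists x; apply/existsP; exists y; apply/and3P.
by split=> //; apply/eqP.
Qed.

(* The capacity operator reads a symmetric function of two vertices as a
   function on undirected edges; here that function is |f x - f y|. *)
Definition gradient (f : Omega -> R) : {set Omega} -> R :=
  capacity (fun x y => `|f x - f y|) (fun=> 1).

Lemma gradientE f x y : x != y -> gradient f [set x; y] = `|f x - f y|.
Proof.
by move=> neq_xy; rewrite /gradient capacityE ?mul1r// => a b; rewrite distrC.
Qed.

Definition path_edges (x : Omega) (p : seq Omega) : seq {set Omega} :=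
  [seq [set u.1; u.2] | u <- zip (x :: p) p].

Lemma path_edges_vertices x p (e : {set Omega}) :
  e \in path_edges x p -> {subset e <= x :: p}.
Proof.
elim: p x => [|y p IHp] x //=; rewrite inE => /orP[/eqP-> z|/IHp sub z /sub].
  by rewrite !inE => /orP[]->; rewrite ?orbT.
by rewrite [in X in _ -> X]inE orbC => ->.
Qed.

(** The first edge contains [x], while the later edges only have vertices in [p], so it cannot
    recur. *)
Lemma path_edges_uniq x p : uniq (x :: p) -> uniq (path_edges x p).
Proof.
elim: p x => [|y p IHp] x // /= /andP[x_notin uniq_p].
rewrite [X in _ && X]IHp // andbT; apply: contra x_notin => /path_edges_vertices.
by apply; rewrite set21.
Qed.

Lemma path_edges_transitions x p :
    path (fun a b => [set a; b] \in transitions P) x p ->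
  {subset path_edges x p <= transitions P}.
Proof.
elim: p x => [|y p IHp] x //= /andP[xy_T path_p] e.
rewrite inE => /orP[/eqP->//|]; exact: IHp.
Qed.

Lemma le_path_gradient f x p : uniq (x :: p) ->
  `|f x - f (last x p)| <= \sum_(e <- path_edges x p) gradient f e.
Proof.
elim: p x => [|y p IHp] x; first by rewrite subrr normr0 big_nil.
rewrite cons_uniq inE negb_or => /andP[/andP[neq_xy _] uniq_p].
rewrite /path_edges /= big_cons gradientE //=.
by apply: le_trans (ler_distD (f y) _ _) _; rewrite lerD2l IHp.
Qed.

Lemma le_Paths_gradient f I F g : g \in Paths P I F ->
  `|f I - f F| <= \sum_(e in transitions P | e \in edges g) gradient f e.
Proof.
rewrite inE /edges; case: (val g) => [|x p] //=.
case/and4P=> /eqP<- /eqP<- path_p uniq_p.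
apply: le_trans (le_path_gradient f uniq_p) _; rewrite -/(path_edges x p).
(* A simple path crosses each edge at most once, so the sum along the list is a sum over the set of
   its edges. *)
rewrite big_uniq ?path_edges_uniq //= le_eqVlt; apply/orP; left; apply/eqP.
apply: eq_bigl => e; case: (boolP (e \in path_edges x p)) => [e_in|_].
  by rewrite (path_edges_transitions path_p e_in).
by rewrite andbF.
Qed.

Lemma edge_prob_ge0 (theta : vertex_seq Omega -> R) e :
  distribution theta -> 0 <= edge_prob theta e.
Proof. by case=> theta_ge0 _; apply: sumr_ge0. Qed.

Lemma routing_gradient f I F theta : is_routing P I F theta ->
  (f I - f F) ^+ 2 <=
  energy P theta * \sum_(e in routing_supp P theta) gradient f e ^+ 2.
Proof.
case=> theta_distr theta_out.
have supp0 e : e \in transitions P -> e \notin routing_supp P theta ->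
    edge_prob theta e = 0.
  move=> e_T; rewrite inE e_T /= -leNgt => le0.
  by apply/eqP; rewrite eq_le le0 edge_prob_ge0.
(* Kept general in [h] because it serves twice: for the linear flow term and for the squares in the
   energy. *)
have supp_sum (h : R -> {set Omega} -> R) : (forall e, h 0 e = 0) ->
    \sum_(e in transitions P) h (edge_prob theta e) e =
    \sum_(e in routing_supp P theta) h (edge_prob theta e) e.
  move=> h0; rewrite [LHS](bigID [in routing_supp P theta]) /=.
  rewrite [X in _ + X]big1 ?addr0 => [|e /andP[eT /(supp0 e eT)->]//].
  by apply: eq_bigl => e; rewrite !inE; case: existsP.
have le_flow : `|f I - f F| <=
    \sum_(e in routing_supp P theta) edge_prob theta e * gradient f e.
  rewrite -(supp_sum (fun p e => p * gradient f e)) => [|e]; last first.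
    by rewrite mul0r.
  (* Writing 1 as the total mass of [theta] and exchanging the sums leaves one inequality per path;
     vertex lists outside [Paths P I F] have mass zero. *)
  rewrite -[leLHS]mul1r -theta_distr.2 mulr_suml.
  under [leRHS]eq_bigr do rewrite mulr_suml.
  rewrite (exchange_big_dep predT) //=; apply: ler_sum => g _.
  have [g_path|/theta_out->] := boolP (g \in Paths P I F); last first.
    by rewrite mul0r big1 // => e _; rewrite mul0r.
  by rewrite -mulr_sumr ler_wpM2l ?theta_distr.1 // le_Paths_gradient.
rewrite -[leLHS]real_normK ?num_real //.
apply: le_trans (_ : _ <= (\sum_(e in routing_supp P theta)
    edge_prob theta e * gradient f e) ^+ 2) _.
  by rewrite ler_sqr ?nnegrE // (le_trans _ le_flow).
apply: le_trans (cauchy_schwarz_sum _ _ _) _.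
by rewrite /energy (supp_sum (fun p _ => p ^+ 2)) // => e; rewrite expr0n.
Qed.

Hypothesis P_reversible : reversible P pi.

(** Ordered pairs are grouped by their underlying edge. Both orientations of an edge contribute the
    same amount by reversibility, which cancels the factor 1/2; all remaining terms are simply
    dropped as nonnegative. *)
Lemma dirichlet_ge_edges f :
    markov_kernel P -> distribution pi ->
  \sum_(e in transitions P) capacity P pi e * gradient f e ^+ 2 <=
  dirichlet P pi f.
Proof.
move=> P_markov [pi_ge0 _].
have w_ge0 x y : 0 <= pi x * P x y * (f x - f y) ^+ 2.
  by rewrite mulr_ge0 ?sqr_ge0 // mulr_ge0 //; case: (P_markov x).
pose edge (u : Omega * Omega) : {set Omega} := [set u.1; u.2].
pose D := [pred u | edge u \in transitions P].
rewrite /dirichlet pair_big /= -(ler_pM2l (ltr0Sn R 1)) mulrA divff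
  ?pnatr_eq0 // mul1r.
rewrite [leRHS](bigID D) /= -[leLHS]addr0 lerD //; last first.
  by apply: sumr_ge0 => u _.
rewrite (partition_big edge [in transitions P]) //=.
rewrite mulr_sumr; apply: ler_sum => e eT.
have /transitionsP[x [y [neq_xy _ eq_e]]] := eT; subst e.
rewrite (bigD1 (x, y)) /=; last by rewrite /edge /= eT eqxx.
rewrite (bigD1 (y, x)) /=; last first.
  by rewrite /edge /= finset.setUC eT eqxx xpair_eqE [y == x]eq_sym (negPf neq_xy).
rewrite capacityE // gradientE // real_normK ?num_real //.
rewrite (P_reversible y x) -[(f y - f x) ^+ 2]sqrrN opprB addrA.
rewrite mulr_natl mulr2n lerDl; apply: sumr_ge0 => u _; exact: w_ge0.
Qed.

Lemma stationary_kernel_pow t y : stationary_distribution P pi ->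
  \sum_x pi x * kernel_pow P t x y = pi y.
Proof.
move=> [_ statP]; elim: t => [|t IHt] /=.
  rewrite (bigD1 y) //= eqxx mulr1 big1 ?addr0 // => x /negPf->.
  by rewrite mulr0.
under eq_bigr do rewrite mulr_sumr.
rewrite exchange_big /= -{}IHt; apply: eq_bigr => z _.
by rewrite -statP mulr_suml; apply: eq_bigr => x _; rewrite mulrA.
Qed.

Lemma kernel_pow_ge0 t x y : markov_kernel P -> 0 <= kernel_pow P t x y.
Proof.
move=> P_markov; elim: t x => [|t IHt] x /=; first exact: ler0n.
by apply: sumr_ge0 => z _; rewrite mulr_ge0 //; case: (P_markov x).
Qed.

(** If [pi y] were 0, stationarity under every power of [P] would make each
    [pi x * kernel_pow P t x y] vanish. Choosing [t] by irreducibility for each [x] gives [pi x = 0]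
    everywhere, against total mass 1. *)
Lemma stationary_gt0 y : markov_kernel P -> irreducible P ->
  stationary_distribution P pi -> 0 < pi y.
Proof.
move=> P_markov irr stat; have [[pi_ge0 pi_sum1] _] := stat.
rewrite lt_neqAle pi_ge0 andbT; apply/eqP => /esym piy0.
have /eqP := oner_neq0 R; apply; rewrite -pi_sum1; apply: big1 => x _.
have [t Pt_gt0] := irr x y; apply/eqP.
have /eqP := stationary_kernel_pow t y stat; rewrite piy0.
rewrite psumr_eq0 => [/allP/(_ x)|z _]; last by rewrite mulr_ge0 ?kernel_pow_ge0.
by rewrite mem_index_enum mulf_eq0 (gt_eqF Pt_gt0) orbF => /(_ isT).
Qed.

Lemma Var_pairs f : distribution pi ->
  Var pi f =
  2^-1 * \sum_(u : Omega * Omega) pi u.1 * pi u.2 * (f u.1 - f u.2) ^+ 2.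
Proof.
move=> [_ pi_sum1]; set m := mean pi f.
(* Centring preserves differences and kills the cross term of the expanded square; each of the two
   square terms then yields one variance. *)
pose g x := f x - m.
have g_mean0 : \sum_x pi x * g x = 0.
  rewrite /g; under eq_bigr do rewrite mulrBr.
  by rewrite sumrB -mulr_suml pi_sum1 mul1r subrr.
rewrite -(pair_bigA _ (fun x y => pi x * pi y * (f x - f y) ^+ 2)) /=.
have -> : \sum_x \sum_y pi x * pi y * (f x - f y) ^+ 2 =
    \sum_x \sum_y (pi x * g x ^+ 2) * pi y
    + \sum_x \sum_y pi x * (pi y * g y ^+ 2)
    - 2 * \sum_x \sum_y (pi x * g x) * (pi y * g y).
  rewrite mulr_sumr -big_split -sumrB /=; apply: eq_bigr => x _.
  rewrite mulr_sumr -big_split -sumrB /=; apply: eq_bigr => y _.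
  by rewrite /g; ring.
rewrite -!big_distrlr /= g_mean0 pi_sum1 mul0r mulr0 subr0 mulr1 mul1r.
by rewrite /Var -/m /g; lra.
Qed.

End Chain.

Theorem lemma14 (R : realType) (Omega : finType)
    (P : Omega -> Omega -> R) (pi : Omega -> R)
    (Theta : Omega -> Omega -> vertex_seq Omega -> R)
    (P_markov : markov_kernel P) (P_lazy : lazy P)
    (P_irreducible : irreducible P)
    (pi_stationary : stationary_distribution P pi)
    (P_reversible : reversible P pi)
    (Theta_routing : forall I F : Omega, is_routing P I F (Theta I F)) :
  (forall f : Omega -> R,
     Var pi f <= En_max P Theta * rho_supp P pi Theta * dirichlet P pi f) /\
  tau_rel P pi <= En_max P Theta * rho_supp P pi Theta.
Proof.
have pi_gt0 x : 0 < pi x by exact: stationary_gt0.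
have pi_distr : distribution pi := pi_stationary.1.
(* The default value 0 of both maxima gives nonnegativity, even over an empty index set. *)
have En_ge0 : 0 <= En_max P Theta by apply: bigmax_ge_id.
have rho_ge0 : 0 <= rho_supp P pi Theta by apply: bigmax_ge_id.
have dirichlet_ge0 f : 0 <= dirichlet P pi f.
  rewrite mulr_ge0 ?invr_ge0 ?ler0n //.
  apply: sumr_ge0 => x _; apply: sumr_ge0 => y _.
  by rewrite mulr_ge0 ?sqr_ge0 // mulr_ge0 ?(ltW (pi_gt0 x)) //; case: (P_markov x).
have capacity_gt0 e : e \in transitions P -> 0 < capacity P pi e.
  by move=> /transitionsP[x [y [neq_xy Pxy ->]]]; rewrite capacityE // mulr_gt0.
have congestion e : e \in transitions P ->
    2^-1 * \sum_(u : Omega * Omega | e \in routing_supp P (Theta u.1 u.2))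
             pi u.1 * pi u.2 <= rho_supp P pi Theta * capacity P pi e.
  move=> eT; rewrite -ler_pdivrMr ?capacity_gt0 // mulrAC -invfM.
  exact: le_bigmax_cond.
have poincare f : Var pi f <=
    En_max P Theta * rho_supp P pi Theta * dirichlet P pi f.
  rewrite Var_pairs // -mulrA.
  (* The middle term is summed edge by edge: [congestion] compares it with the Dirichlet form, and
     exchanging the sums back to pairs compares it with the variance through [routing_gradient]. *)
  apply: le_trans (_ : _ <= En_max P Theta * \sum_(e in transitions P)
      (2^-1 * \sum_(u : Omega * Omega | e \in routing_supp P (Theta u.1 u.2))
                pi u.1 * pi u.2) * gradient f e ^+ 2) _; last first.
    apply: ler_wpM2l => //.
    have le_dir := dirichlet_ge_edges P_reversible f P_markov pi_distr.
    apply: le_trans (ler_wpM2l rho_ge0 le_dir).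
    rewrite mulr_sumr; apply: ler_sum => e eT.
    by rewrite [leRHS]mulrA ler_wpM2r ?sqr_ge0 ?congestion.
  under [X in _ <= _ * X]eq_bigr do rewrite -mulrA mulr_suml.
  rewrite -mulr_sumr mulrCA ler_pM2l ?invr_gt0 ?ltr0n //.
  rewrite (exchange_big_dep predT) //= mulr_sumr; apply: ler_sum => -[I F] _ /=.
  rewrite -mulr_sumr [leRHS]mulrCA; apply: ler_wpM2l; first by rewrite mulr_ge0 ?ltW.
  apply: le_trans (routing_gradient f (Theta_routing I F)) _.
  have -> : \sum_(e in transitions P | e \in routing_supp P (Theta I F))
        gradient f e ^+ 2 =
      \sum_(e in routing_supp P (Theta I F)) gradient f e ^+ 2.
    by apply: eq_bigl => e; rewrite !inE; case: existsP.
  apply: ler_wpM2r; first by apply: sumr_ge0 => e _; apply: sqr_ge0.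
  exact: (le_bigmax _ (fun u => energy P (Theta u.1 u.2)) (I, F)).
split=> //.
(* The product may vanish (one-point space), whereas Poincare constants are
   positive, hence the perturbation. *)
apply/ler_addgt0Pr => eps eps_gt0; apply: ge_inf.
  by exists 0 => C [/ltW].
split=> [|f]; first by rewrite ltr_wpDl ?mulr_ge0.
by apply: le_trans (poincare f) _; rewrite ler_wpM2r // lerDl ltW.
Qed.
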